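(* Let $N,M\ge 1$ be integers, let $\bm{A}_{\mathrm{intra}}\in\mathbb{R}^{N\times N}$ and $\bm{A}_{\mathrm{inter}}\in\mathbb{R}^{M\times M}$ have zero diagonal, and let $\omega_{\mathrm{intra}},\omega_{\mathrm{inter}}\in\mathbb{R}$. Suppose that $\bm{\psi}=(\psi_1,\dots,\psi_N)$ is a solution of $$\frac{d\psi_i}{dt}=\omega_{\mathrm{intra}}+\sum_{j=1}^{N}(\bm{A}_{\mathrm{intra}})_{ij}\sin(\psi_j-\psi_i),\qquad 1\le i\le N,$$ that $\bm{\phi}=(\phi_1,\dots,\phi_M)$ is a solution of $$\frac{d\phi_l}{dt}=\omega_{\mathrm{inter}}+\sum_{k=1}^{M}(\bm{A}_{\mathrm{inter}})_{lk}\sin(\phi_k-\phi_l),\qquad 1\le l\le M,$$ and that $\bm{\theta}=(\theta_1,\dots,\theta_{NM})$ is the composed solution, $\theta_{N(l-1)+i}(t)=\psi_i(t)+\phi_l(t)$ for $1\le l\le M$, $1\le i\le N$, of the multiplex system $$\frac{d\theta_i}{dt}=(\omega_{\mathrm{inter}}+\omega_{\mathrm{intra}})+\sum_{j=1}^{NM}\bm{K}_{ij}\sin(\theta_j-\theta_i),\qquad \bm{K}=\bm{A}_{\mathrm{intra}}\bigoplus\bm{A}_{\mathrm{inter}}.$$ Then the Kuramoto order parameters satisfy, for every $t$, $$R(t)=R_{\mathrm{intra}}(t)\,R_{\mathrm{inter}}(t).$$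
   Context: The Kuramoto order parameters are $$R(t)=\frac{1}{NM}\Big|\sum_{j=1}^{NM}e^{\mathrm{i}\theta_j(t)}\Big|,\qquad R_{\mathrm{intra}}(t)=\frac1N\Big|\sum_{j=1}^{N}e^{\mathrm{i}\psi_j(t)}\Big|,\qquad R_{\mathrm{inter}}(t)=\frac1M\Big|\sum_{j=1}^{M}e^{\mathrm{i}\phi_j(t)}\Big|.$$ Phases are regarded as real numbers (modulo $2\pi$). Kronecker product convention: for $\bm{A}\in\mathbb{R}^{p\times q}$ and $\bm{B}=[b_{ij}]\in\mathbb{R}^{r\times s}$, $\bm{A}\otimes\bm{B}$ is the block matrix whose $(i,j)$ block is $\bm{A}b_{ij}$. For $\bm{A}\in\mathbb{R}^{r\times r}$, $\bm{B}\in\mathbb{R}^{s\times s}$, the Kronecker sum is $\bm{A}\bigoplus\bm{B}=\bm{A}\otimes\bm{I}_s+\bm{I}_r\otimes\bm{B}$, with $\bm{I}_k$ the $k\times k$ identity. Hence $\bm{K}$ has $M\times M$ blocks of size $N\times N$, with diagonal blocks $\bm{A}_{\mathrm{intra}}$ and $(l,k)$ block $(\bm{A}_{\mathrm{inter}})_{lk}\bm{I}_N$ for $l\ne k$. *)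

(* Defs.v *)
From mathcomp Require Import all_boot all_order all_algebra.
From mathcomp Require Import all_classical all_reals all_analysis.
From mathcomp.real_closed Require Import complex mxtens.

Set Implicit Arguments.
Unset Strict Implicit.
Unset Printing Implicit Defensive.

Import Order.TTheory GRing.Theory Num.Theory.
Import numFieldNormedType.Exports.

Local Open Scope classical_set_scope.
Local Open Scope ring_scope.

(* Equality of phases, i.e. of real numbers modulo 2 pi. *)
Definition phase_eq (R : realType) (x y : R) : Prop :=
  exists k : int, x = y + k%:~R * (2 * pi).

(* Derivative of f at t relative to the time set J: for t interior to J this is
   the usual derivative, at an end point of J that belongs to J it is the
   one-sided derivative. *)
Definition is_derive_in (R : realType) (J : set R) (t : R) (f : R -> R) (v : R)
    : Prop :=
  h^-1 * (f (t + h) - f t) @[h --> within [set h | J (t + h)] 0^'] --> v.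

Definition kuramoto_solution (R : realType) (J : set R) (n : nat)
    (omega : R) (A : 'M[R]_n) (x : 'I_n -> R -> R) : Prop :=
  forall (t : R) (i : 'I_n), J t ->
    is_derive_in J t (x i) (omega + \sum_(j < n) A i j * sin (x j t - x i t)).

(* In the convention used here the (i, j) block of kron A B is B i j *: A,
   whereas the (i, j) block of tensmx A B is A i j *: B. *)
Definition kron (R : realType) (p q r s : nat)
    (A : 'M[R]_(p, q)) (B : 'M[R]_(r, s)) : 'M[R]_(r * p, s * q) :=
  tensmx B A.

Definition kron_sum (R : realType) (r s : nat) (A : 'M[R]_r) (B : 'M[R]_s)
    : 'M[R]_(s * r) :=
  kron A (1%:M : 'M[R]_s) + kron (1%:M : 'M[R]_r) B.

(* e^{i x} *)
Definition expi (R : realType) (x : R) : complex R := Complex (cos x) (sin x).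

Definition order_param (R : realType) (n : nat) (x : 'I_n -> R -> R) (t : R)
    : R :=
  n%:R^-1 * ComplexField.Normc.normc (\sum_(j < n) expi (x j t)).

(* With 0-based indices, mxtens_index (l, i) : 'I_(M * N) is l * N + i. *)
Definition composed (R : realType) (J : set R) (N M : nat)
    (psi : 'I_N -> R -> R) (phi : 'I_M -> R -> R) (theta : 'I_(M * N) -> R -> R)
    : Prop :=
  forall (t : R) (l : 'I_M) (i : 'I_N), J t ->
    phase_eq (theta (mxtens_index (l, i)) t) (psi i t + phi l t).

(* Main.v *)
Require Import Defs.
From mathcomp Require Import all_boot all_order all_algebra.
From mathcomp Require Import all_classical all_reals all_analysis.
From mathcomp.real_closed Require Import complex mxtens.

Import Order.TTheory GRing.Theory Num.Theory.
Import numFieldNormedType.Exports.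

Local Open Scope classical_set_scope.
Local Open Scope ring_scope.

(** The mean field of the composed phases factors.  Since
    e^{i (psi + phi)} = e^{i psi} e^{i phi} ([expiD]), the sum of e^{i theta}
    over all oscillators runs over pairs of a layer and a node, and equals the
    product of the sums for phi and psi; the complex modulus and the
    normalisation 1/(NM) are multiplicative too.  That theta is only known
    modulo 2 pi does not matter, because e^{i x} is 2 pi-periodic
    ([expi_phase]). *)

Lemma expiD (R : realType) (x y : R) : expi (x + y) = expi x * expi y.
Proof. by rewrite /expi cosD sinD [sin x * _ + _]addrC. Qed.

Lemma expi_periodic (R : realType) (x : R) : expi (x + pi *+ 2) = expi x.
Proof. by rewrite /expi cosD2pi sinD2pi. Qed.

Lemma expi_phase (R : realType) (x y : R) : phase_eq x y -> expi x = expi y.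
Proof.
case=> k ->; rewrite mulr_natl mulrzl.
case: k => n; first exact: periodicn (@expi_periodic R) n y.
(* For a negative number of turns, the period is added back. *)
rewrite NegzE mulrNz -[LHS](periodicn (@expi_periodic R) n.+1).
by rewrite subrK.
Qed.

Theorem mainTheorem2 (R : realType) (N M : nat)
    (hN : (1 <= N)%N) (hM : (1 <= M)%N)
    (Aintra : 'M[R]_N) (Ainter : 'M[R]_M)
    (hAintra : forall i : 'I_N, Aintra i i = 0)
    (hAinter : forall l : 'I_M, Ainter l l = 0)
    (omega_intra omega_inter : R)
    (J : set R) (hJ : is_interval J)
    (psi : 'I_N -> R -> R) (phi : 'I_M -> R -> R) (theta : 'I_(M * N) -> R -> R)
    (hpsi : kuramoto_solution J omega_intra Aintra psi)
    (hphi : kuramoto_solution J omega_inter Ainter phi)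
    (hcomposed : composed J psi phi theta)
    (htheta : kuramoto_solution J (omega_inter + omega_intra)
                (kron_sum Aintra Ainter) theta) :
  forall t : R, J t ->
    order_param theta t = order_param psi t * order_param phi t.
Proof.
move=> t Jt; rewrite /order_param.
have -> : \sum_(k < M * N) expi (theta k t) =
          (\sum_(l < M) expi (phi l t)) * (\sum_(i < N) expi (psi i t)).
  rewrite mulr_sum; apply: eq_bigr => k _.
  case: (mxtens_indexP k) => l i; rewrite mxtens_indexK /=.
  by rewrite (expi_phase _ _ _ (hcomposed t l i Jt)) expiD mulrC.
by rewrite ComplexField.Normc.normcM natrM invfM mulrACA mulrC.
Qed.
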